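(* Let $n,m$ be coprime integers with $2\le n<m$, and let $\mathcal{M}(n,m)$ be the monoid with generators $\rho_1,\dots,\rho_n$ and relations $\rho_1\rho_n^q\rho_i=\rho_{i+1}\rho_n^{q+D(i)}$ for $1\le i\le n-1$ (with $q,r,D(i)$ as in the context). (1) The right-lcm of the generators $\rho_1,\dots,\rho_n$ of $\mathcal{M}(n,m)$ is $\rho_n^{m-q}$. (2) The left-lcm of the generators $\rho_1,\dots,\rho_n$ of $\mathcal{M}(n,m)$ is $\rho_{n-1}\rho_n^{q(n-2)+r-1}$ if $D(1)=1$, and $\rho_n^{m-q}$ if $D(1)=0$.
   Context: Notation: write $m=qn+r$ for the Euclidean division of $m$ by $n$, so $0<r<n$. For $i\in\mathbb{Z}$ let $k_i$ be the unique integer in $\{1,\dots,n\}$ with $k_i\equiv ir \pmod n$, and let $D(i):=\frac{r+k_i-k_{i+1}}{n}$, which equals $1$ if $k_i+r>n$ and $0$ otherwise (so, as $k_1=r$, $D(1)=1$ iff $2r>n$). In a monoid, if $ab=c$ then $a$ left-divides $c$ and $c$ is a right-multiple of $a$; $b$ right-divides $c$ and $c$ is a left-multiple of $b$. The right-lcm of a finite family is a common right-multiple that left-divides every common right-multiple; the left-lcm is a common left-multiple that right-divides every common left-multiple. *)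

(* Defs.v *)
From HB Require Import structures.
From mathcomp Require Export all_boot.
From mathcomp Require Import generic_quotient boolp.

Set Implicit Arguments.
Unset Strict Implicit.
Unset Printing Implicit Defensive.

Section Divisibility.
Local Open Scope group_scope.
Variable M : monoidType.
Implicit Types a b c x y : M.

Definition left_divides a c := exists b, a * b = c.
Definition right_divides b c := exists a, a * b = c.

Definition is_right_lcm (I : finType) (f : I -> M) x :=
  (forall i, left_divides (f i) x) /\
  (forall y, (forall i, left_divides (f i) y) -> left_divides x y).

Definition is_left_lcm (I : finType) (f : I -> M) x :=
  (forall i, right_divides (f i) x) /\
  (forall y, (forall i, right_divides (f i) y) -> right_divides x y).

End Divisibility.

(* Monoid presentations: the quotient of the free monoid [seq A] by the least
   congruence containing the set [R] of defining relations. *)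

Inductive congr_gen (A : Type) (R : seq A -> seq A -> Prop) :
    seq A -> seq A -> Prop :=
| cg_rel u v of R u v : congr_gen R u v
| cg_refl u : congr_gen R u u
| cg_sym u v of congr_gen R u v : congr_gen R v u
| cg_trans u v w of congr_gen R u v & congr_gen R v w : congr_gen R u w
| cg_cat u u' v v' of congr_gen R u u' & congr_gen R v v' :
    congr_gen R (u ++ v) (u' ++ v').

Section Presentation.
Local Open Scope quotient_scope.
Local Open Scope group_scope.
Variables (A : choiceType) (R : seq A -> seq A -> Prop).

Definition congr_rel : rel (seq A) := fun u v => `[< congr_gen R u v >].

Lemma congr_rel_refl : reflexive congr_rel.
Proof. by move=> u; apply/asboolP; apply: cg_refl. Qed.

Lemma congr_rel_sym : symmetric congr_rel.
Proof. by move=> u v; apply/asboolP/asboolP; apply: cg_sym. Qed.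

Lemma congr_rel_trans : transitive congr_rel.
Proof. by move=> v u w /asboolP uv /asboolP vw; apply/asboolP/(cg_trans uv). Qed.

Canonical congr_equiv :=
  EquivRel congr_rel congr_rel_refl congr_rel_sym congr_rel_trans.

Definition presented := {eq_quot congr_equiv}.

HB.instance Definition _ := Choice.on presented.

Definition word_class (u : seq A) : presented := \pi_{eq_quot congr_equiv} u.

Lemma word_class_eqP u v : word_class u = word_class v <-> congr_gen R u v.
Proof.
split=> [/eqmodP/asboolP // | uv].
by apply/eqmodP/asboolP.
Qed.

Definition presented_word (x : presented) : seq A :=
  repr (x : {eq_quot congr_equiv}).

Lemma presented_wordK : cancel presented_word word_class.
Proof. by move=> x; rewrite /word_class /presented_word reprK. Qed.

Definition presented_one : presented := word_class [::].

Definition presented_mul (x y : presented) : presented :=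
  word_class (presented_word x ++ presented_word y).

Lemma presented_mulE u v :
  presented_mul (word_class u) (word_class v) = word_class (u ++ v).
Proof.
by apply/word_class_eqP/cg_cat; apply/word_class_eqP; rewrite presented_wordK.
Qed.

Lemma presented_mulA : associative presented_mul.
Proof.
move=> x y z; rewrite -[x]presented_wordK -[y]presented_wordK.
by rewrite -[z]presented_wordK !presented_mulE catA.
Qed.

Lemma presented_mul1g : left_id presented_one presented_mul.
Proof. by move=> x; rewrite -[x]presented_wordK presented_mulE. Qed.

Lemma presented_mulg1 : right_id presented_one presented_mul.
Proof. by move=> x; rewrite -[x]presented_wordK presented_mulE cats0. Qed.

HB.instance Definition _ :=
  isMonoid.Build presented presented_mulA presented_mul1g presented_mulg1.

Definition generator (a : A) : presented := word_class [:: a].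

Lemma word_class_cat u v : word_class (u ++ v) = word_class u * word_class v.
Proof. by rewrite -presented_mulE. Qed.

Lemma word_class_prod u : word_class u = \prod_(a <- u) generator a.
Proof.
elim: u => [|a u IHu]; first by rewrite big_nil.
by rewrite big_cons -IHu -word_class_cat.
Qed.

End Presentation.

Section TorusMonoid.
Variables n m : nat.

Local Notation q := (m %/ n).
Local Notation r := (m %% n).

(* Only indices i >= 0 occur in the presentation. *)
Definition kk (i : nat) : nat :=
  if i * r %% n == 0 then n else i * r %% n.

Definition DD (i : nat) : nat := (r + kk i - kk i.+1) %/ n.

(* The generators are numbered 1, ..., n as in the mathematics, [rho_letter i]
   being the letter with ordinal value i.-1; the alphabet ['I_n.-1.+1] has
   exactly n letters as soon as n > 0. *)
Definition rho_letter (i : nat) : 'I_n.-1.+1 := inord i.-1.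

Definition torus_rel (u v : seq 'I_n.-1.+1) : Prop :=
  exists i : nat,
    [/\ 1 <= i <= n.-1,
        u = rho_letter 1 :: nseq q (rho_letter n) ++ [:: rho_letter i]
      & v = rho_letter i.+1 :: nseq (q + DD i) (rho_letter n)].

Definition torus_monoid := presented torus_rel.
HB.instance Definition _ := Monoid.on torus_monoid.

Definition rho (i : nat) : torus_monoid := generator torus_rel (rho_letter i).

Definition rho_family (i : 'I_n) : torus_monoid := rho i.+1.

Hypothesis n_gt0 : 0 < n.

Lemma kk_spec i : (1 <= kk i <= n) /\ kk i = i * r %[mod n].
Proof.
rewrite /kk; case: eqP => [ir0 | /eqP ir0].
  by rewrite n_gt0 leqnn modnn ir0.
by rewrite lt0n ir0 ltnW ?ltn_pmod // modn_mod.
Qed.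

Lemma kk_uniq i j : 1 <= j <= n -> j = i * r %[mod n] -> j = kk i.
Proof.
case/andP=> j1 jn eqj; rewrite /kk -eqj.
case: (ltngtP j n) jn => // [ltjn | ->] _; last by rewrite modnn.
by rewrite modn_small // eqn0Ngt j1.
Qed.

Lemma DDE i : r + kk i = DD i * n + kk i.+1 /\ DD i = (n < kk i + r) :> nat.
Proof.
have [/andP[k1 kn] ek] := kk_spec i.
have rn : r < n by rewrite ltn_pmod.
have eS : kk i + r = i.+1 * r %[mod n].
  by rewrite -modnDml ek modnDml mulSn addnC.
rewrite /DD addnC; case: ltnP => [lt | ge].
  have <- : kk i + r - n = kk i.+1.
    apply: kk_uniq; last by rewrite -eS -{2}(subnK (ltnW lt)) modnDr.
    by rewrite subn_gt0 lt leq_subLR leq_add // ltnW.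
  by rewrite subKn ?(ltnW lt) // divnn n_gt0 mul1n subnKC // ltnW.
have <- : kk i + r = kk i.+1 by apply: kk_uniq; rewrite // ge ltn_addr.
by rewrite subnn div0n.
Qed.

End TorusMonoid.

(* Main.v *)
Require Import Defs.
From mathcomp Require Import order ssralg ssrnum ssrint intdiv zify ring.

(** The group [< x, y | x^n = y^m >] contains copies of the generators,
    [rho_i = x^i y^(-f i)] with [n * f i + k_i = i * m], where [f] is [yexp]; so
    [rho_n = y] and [x = rho_1 y^q].  Every element of the group has a unique
    normal form [y^z x^j1 y^b1 ... x^jl y^bl] with [0 < j < n],
    [0 <= b + f j < m] and [b] not divisible by [m] except possibly the last
    one.  The monoid acts on normal forms by left multiplication, and
    since [x^j y^b = rho_j y^(b + f j)] a normal form with [0 <= z] can be read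
    back in the monoid; this solves the word problem and shows that [y^l]
    left-divides [g] exactly when [l <= z].  For (1), the [z] of [rho_{n-1} h]
    is a multiple of [m] or at least [m - q].  For (2), if [rho_i]
    right-divides [g] then [g rho_i^-1] has [0 <= z]; comparing this for
    [i = 1, 2] with the last syllable of [g] forces [y^(m-q)] to
    right-divide [g], except that [g] may also end in [x^(n-1) y^(-q)] when
    [D(1) = 1].  Uniqueness holds because the monoid is graded by the positive
    weights [k_i]. *)

Section TorusMonoid.
Set Implicit Arguments.
Unset Strict Implicit.
Unset Printing Implicit Defensive.
Import Order.TTheory GRing.Theory Num.Theory.
Variables n m : nat.
Hypotheses (n_ge2 : 2 <= n) (ltnm : n < m) (co_nm : coprime n m).

Local Notation q := (m %/ n).
Local Notation r := (m %% n).
Local Notation k := (kk n m).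
Local Notation D := (DD n m).

(** * Arithmetic of the exponents [yexp] and the residues [k] *)

Definition yexp (i : nat) : nat := i * q + \sum_(1 <= j < i) D j.

Lemma yexpS i : 0 < i -> yexp i.+1 = yexp i + q + D i.
Proof. by move=> i_gt0; rewrite /yexp big_nat_recr //=; lia. Qed.

Lemma yexp1 : yexp 1 = q.
Proof. by rewrite /yexp big_geq // mul1n addn0. Qed.

Lemma r_gt0 : 0 < r.
Proof.
rewrite lt0n; apply/eqP => /eqP/gcdn_idPl gnm.
by move: co_nm; rewrite /coprime gnm; lia.
Qed.

Lemma kk1 : k 1 = r.
Proof.
have n_gt0 : 0 < n by lia.
have rn : r < n by rewrite ltn_pmod.
by symmetry; apply: kk_uniq => //; rewrite ?mul1n // r_gt0 ltnW.
Qed.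

Lemma kkn : k n = n.
Proof. by rewrite /kk modnMr. Qed.

(** Telescoping: the increment of [n * yexp] at [i] is [n * (q + D i) = m + k i - k i.+1]. *)
Lemma yexpE i : 0 < i -> n * yexp i + k i = i * m.
Proof.
have n_gt0 : 0 < n by lia.
elim: i => [//|[_ _|i IHi _]].
  by rewrite yexp1 kk1 mul1n [RHS](divn_eq m n) mulnC.
have [DDi _] := DDE m n_gt0 i.+1.
rewrite (@yexpS i.+1) //.
have := IHi isT; have := divn_eq m n; nia.
Qed.

Lemma kk_bounds i : 0 < k i <= n.
Proof. by have [|] := @kk_spec n m _ i; first lia. Qed.

Lemma yexpn : (yexp n).+1 = m.
Proof.
have /eqP := @yexpE n (ltnW n_ge2); rewrite kkn -mulnSr.
by rewrite eqn_mul2l; case/orP=> /eqP //; lia.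
Qed.

Lemma leq_yexp i j : 0 < i -> i <= j -> yexp i <= yexp j.
Proof.
move=> i_gt0; elim: j => [|j IHj]; first lia.
rewrite leq_eqVlt => /orP[/eqP->//|ltij].
rewrite yexpS; last by apply: leq_trans i_gt0 _.
by rewrite -addnA (leq_trans (IHj _)) ?leq_addr.
Qed.

Lemma yexp_lt i : 0 < i <= n -> yexp i < m.
Proof. by case/andP=> i_gt0 lein; rewrite -yexpn ltnS leq_yexp. Qed.

Lemma yexp_pred : yexp n.-1 + q = m.-1.
Proof.
have n_gt0 : 0 < n by lia.
have eS : yexp n = yexp n.-1 + q + D n.-1 by rewrite -yexpS ?prednK //; lia.
(* As [k n = n], the value 1 would require [r + k n.-1 = 2 * n], but [r < n] and [k n.-1 <= n]. *)
have D0 : D n.-1 = 0.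
  have [] := DDE m n_gt0 n.-1; rewrite prednK // kkn => e1 e2.
  move: e1; rewrite e2; case: ltnP => // _ e1; exfalso.
  by have := kk_bounds n.-1; have := ltn_pmod m n_gt0; move: e1; clear; lia.
by have := congr1 predn yexpn; rewrite eS D0 addn0.
Qed.

Lemma DD_le1 i : D i <= 1.
Proof. by have [_ ->] := DDE m (ltnW n_ge2) i; case: ltnP. Qed.

Lemma yexp2 : yexp 2 = q + q + D 1.
Proof. by rewrite yexpS // yexp1. Qed.

(** * Consequences of the relations inside the monoid *)

Local Open Scope group_scope.
Local Notation rho := (rho n m).
Local Notation y := (rho n).
Local Notation x := (rho 1 * y ^+ q).

Lemma word_class_nseq (A : choiceType) (R : seq A -> seq A -> Prop) c (a : A) :
  word_class R (nseq c a) = generator R a ^+ c.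
Proof.
elim: c => [//|c IHc] /=.
by rewrite -cat1s word_class_cat IHc expgS.
Qed.

Lemma x_rho i : 0 < i < n -> x * rho i = rho i.+1 * y ^+ (q + D i).
Proof.
move=> lti; have : torus_rel m (rho_letter n 1 :: nseq q (rho_letter n n) ++
    [:: rho_letter n i]) (rho_letter n i.+1 :: nseq (q + D i) (rho_letter n n)).
  by exists i; split=> //; lia.
move/(@cg_rel _ (@torus_rel n m)) => /(word_class_eqP (@torus_rel n m)).
rewrite -cat1s catA !word_class_cat word_class_nseq => ->.
by rewrite -cat1s word_class_cat word_class_nseq.
Qed.

Lemma expx_rho i j : 0 < i -> i + j <= n ->
  x ^+ j * rho i = rho (i + j) * y ^+ (yexp (i + j) - yexp i).
Proof.
move=> i_gt0; elim: j => [|j IHj] leij;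
  first by rewrite addn0 subnn mul1g mulg1.
rewrite expgS -mulgA IHj; last lia.
rewrite mulgA x_rho; last lia.
rewrite -mulgA -expgnDr addnS yexpS; last lia.
refine (congr1 (fun c => rho (i + j).+1 * y ^+ c) _).
by rewrite addnBA ?leq_yexp ?leq_addr // addnC addnA.
Qed.

(** Iterating the relation up to index [n] ends in [rho n = y], which joins the power of [y] behind
    it. *)
Lemma expx_rhoC i : 0 < i <= n -> x ^+ (n - i) * rho i = y ^+ (m - yexp i).
Proof.
case/andP=> i_gt0 lein; have := leq_yexp i_gt0 lein.
rewrite expx_rho ?subnKC // -expgS => lef.
by rewrite -(subSn lef) yexpn.
Qed.

Lemma expx i : 0 < i <= n -> x ^+ i = rho i * y ^+ yexp i.
Proof.
case: i => // i hi; rewrite expgSr mulgA expx_rho ?add1n //.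
by rewrite -mulgA -expgnDr yexp1 subnK // -[leqLHS]yexp1 leq_yexp.
Qed.

Lemma expx_n : x ^+ n = y ^+ m.
Proof. by rewrite expx -?expgS ?yexpn // leqnn (ltnW n_ge2). Qed.

Lemma expx_rho_wrap i j : 0 < i < n -> j < n -> n < i + j ->
  x ^+ j * rho i = rho (i + j - n) * y ^+ (yexp (i + j - n) + m - yexp i).
Proof.
move=> hi ltj ltij; have ltfi : yexp i < m by apply: yexp_lt; lia.
have {1}-> : j = (i + j - n) + (n - i) by lia.
rewrite expgnDr -mulgA expx_rhoC; last lia.
rewrite expx; last lia.
by rewrite -mulgA -expgnDr addnBA // ltnW.
Qed.

(** Centrality without cancellation: write [y^m = x^i x^(n-i)], collapse [x^(n-i) rho_i] to a power
    of [y], and expand [x^i] as [rho_i y^(yexp i)]. *)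
Lemma expym_rho i : 0 < i <= n -> y ^+ m * rho i = rho i * y ^+ m.
Proof.
move=> hi; have eX : x ^+ n = x ^+ i * x ^+ (n - i).
  by rewrite -expgnDr subnKC //; case/andP: hi.
rewrite -{1}expx_n eX -mulgA expx_rhoC // expx // -mulgA -expgnDr.
by rewrite subnKC ?(ltnW (yexp_lt _)).
Qed.

(** * Normal forms and the action of powers of [x] on them *)

Local Notation "l %:Z" := (Posz l) (only parsing).

(* [(z, [:: (j1, b1); ...])] stands for [y^z x^j1 y^b1 ...]. *)
Definition state : Type := int * seq (nat * int).

Implicit Types (z b c : int) (w : seq (nat * int)) (s : state).

Definition shift c s : state := ((c + s.1)%R, s.2).

Fixpoint reduced w : bool :=
  if w is (j, b) :: w' then
    [&& 0 < j < n, (0 <= b + (yexp j)%:Z)%R, (b + (yexp j)%:Z < m%:Z)%R,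
        nilp w' || ~~ (m %| b)%Z & reduced w']
  else true.

(* Normal form of [y^z x^p y^b w] when [m] divides [z], so that [y^z] is
   central; [p] is arbitrary and is reduced with [x^n = y^m]. *)
Definition normalize p z b w : state :=
  let z' := (z + (m * (p %/ n))%N%:Z)%R in
  let j := p %% n in
  if j == 0 then ((z' + b)%R, w) else
  let a := (((b + (yexp j)%:Z) %/ m)%Z * m%:Z)%R in
  ((z' + a)%R, (j, (b - a)%R) :: w).

(** Left multiplication by [x^i]. A central [y^z] is passed over, so [x^i] merges with the first
    syllable; any other [y^z] becomes the tail of a new syllable [x^i y^z]. *)
Definition xact i s : state :=
  if (m %| s.1)%Z then
    if s.2 is (j, b) :: w then normalize (i + j) s.1 b w
    else normalize i s.1 0 [::]
  else normalize i 0 s.1 s.2.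

Lemma shiftD b c s : shift b (shift c s) = shift (b + c)%R s.
Proof. by rewrite /shift /= addrA. Qed.

Lemma shift0 s : shift 0%R s = s.
Proof. by case: s => z w; rewrite /shift /= add0r. Qed.

Lemma m_neq0 : m%:Z != 0%R.
Proof. by rewrite eqz_nat -lt0n (leq_ltn_trans _ ltnm). Qed.

Lemma normalizeD p c z b w :
  normalize p (c + z)%R b w = shift c (normalize p z b w).
Proof. by rewrite /normalize /shift; case: eqP => _ /=; rewrite -!addrA. Qed.

Lemma normalizeM p c z b w : (m %| c)%Z ->
  normalize p (c + z)%R b w = normalize p z (c + b)%R w.
Proof.
case/dvdzP=> a ->; rewrite /normalize; case: eqP => _.
  by congr (_, _); ring.
rewrite -[(a * m%:Z + b + _)%R]addrA divzMDl ?m_neq0 //.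
by congr (_, (_, _) :: _); ring.
Qed.

Lemma normalize_addn p l z b w :
  normalize (p + l * n) z b w = normalize p (z + (m * l)%N%:Z)%R b w.
Proof.
rewrite /normalize addnC modnMDl divnMDl ?(ltnW n_ge2) //.
by rewrite mulnDr PoszD; case: eqP => _; congr (_, _); ring.
Qed.

(** On unreduced data [x^i] just adds to the exponent [p], which makes [xact] additive. If [n]
    divides [p], then [y^b] becomes the leading power; the condition on [b] prevents a merge with
    [w]. *)
Lemma xact_normalize i p z b w : (m %| z)%Z -> nilp w || ~~ (m %| b)%Z ->
  xact i (normalize p z b w) = normalize (i + p) z b w.
Proof.
move=> mz hw; have mM l : (m %| (m * l)%N%:Z)%Z by rewrite PoszM dvdz_mulr.
have -> : normalize (i + p) z b w =
    normalize (i + p %% n) (z + (m * (p %/ n))%N%:Z)%R b w.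
  by rewrite -normalize_addn -addnA [_ %% n + _]addnC -divn_eq.
rewrite [normalize p _ _ _]/normalize.
have := mM (p %/ n); set z' := (z + _)%R => mM'.
have {mM'}mz' : (m %| z')%Z by rewrite rpredD.
case: eqP => [-> | p0]; rewrite /xact /=.
  rewrite addn0 rpredDl //; case: ifP => [mb | _].
    move: hw; rewrite mb orbF => /nilP ->.
    by rewrite [(z' + b)%R]addrC normalizeM // addr0.
  by rewrite -[in RHS](addr0 z') normalizeM.
have ma : (m %| (((b + (yexp (p %% n))%:Z) %/ m)%Z * m%:Z)%R)%Z.
  by rewrite dvdz_mull.
by rewrite rpredD // [(z' + _)%R]addrC normalizeM // subrKC.
Qed.

Lemma reduced_normalize p z b w : nilp w || ~~ (m %| b)%Z -> reduced w ->
  reduced (normalize p z b w).2.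
Proof.
move=> hw ok_w; rewrite /normalize; case: eqP => [// | /eqP p0] /=.
have m0 := m_neq0.
have mgt0 : (0 < m%:Z)%R by rewrite ltz_nat (leq_ltn_trans _ ltnm).
rewrite lt0n p0 ltn_pmod ?(ltnW n_ge2) //= ok_w andbT.
set e := (b + (yexp (p %% n))%:Z)%R.
have -> : (b - (e %/ m)%Z * m%:Z + (yexp (p %% n))%:Z)%R = (e %% m)%Z.
  by rewrite [RHS]/modz /e; ring.
rewrite modz_ge0 // ltz_pmod //= rpredBr ?dvdz_mull //.
Qed.

(** This brings every reduced state within reach of [xact_normalize]: when [m] does not divide the
    leading exponent, that exponent serves as [b] with [p = 0]. *)
Lemma normalizeP s : reduced s.2 -> exists p z b w,
  [/\ s = normalize p z b w, (m %| z)%Z, nilp w || ~~ (m %| b)%Z & reduced w].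
Proof.
case: s => z w /= ok_w; case: (boolP (m %| z)%Z) => mz; last first.
  exists 0, 0%R, z, w; split; rewrite ?dvdz0 ?mz ?orbT //.
  by rewrite /normalize mod0n div0n muln0 addr0 add0r.
case: w ok_w => [_|[j b] w /= /and5P[hj b1 b2 hw ok_w]].
  exists 0, z, 0%R, [::]; split=> //.
  by rewrite /normalize mod0n div0n muln0 !addr0.
exists j, z, b, w; split=> //.
have [j0 jn] := andP hj; rewrite /normalize modn_small // divn_small //.
rewrite divz_small; last by rewrite b1.
rewrite eqn0Ngt j0 muln0 mul0r !addr0.
by congr (_, (_, _) :: _); rewrite oppr0 addr0.
Qed.

Lemma reduced_xact i s : reduced s.2 -> reduced (xact i s).2.
Proof.
case/normalizeP=> p [z [b [w [-> mz hw ok_w]]]].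
by rewrite xact_normalize // reduced_normalize.
Qed.

Lemma xactD i j s : reduced s.2 -> xact i (xact j s) = xact (i + j) s.
Proof.
case/normalizeP=> p [z [b [w [-> mz hw ok_w]]]].
by rewrite !xact_normalize // addnA.
Qed.

Lemma xact_n s : reduced s.2 -> xact n s = shift m%:Z s.
Proof.
case/normalizeP=> p [z [b [w [-> mz hw ok_w]]]].
rewrite xact_normalize // addnC -{1}[n]mul1n normalize_addn muln1 addrC.
exact: normalizeD.
Qed.

(** * The action of the monoid on normal forms *)

Definition rho_act i s : state := xact i (shift (- (yexp i)%:Z)%R s).

Lemma reduced_rho_act i s : reduced s.2 -> reduced (rho_act i s).2.
Proof. by move=> ?; apply: reduced_xact. Qed.

Lemma rho_actn s : reduced s.2 -> rho_act n s = shift 1 s.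
Proof.
move=> ok_s; rewrite /rho_act xact_n // shiftD.
by congr shift; have := yexpn; lia.
Qed.

Definition word_act (u : seq 'I_n.-1.+1) s : state :=
  foldr (fun a : 'I_n.-1.+1 => rho_act a.+1) s u.

Lemma reduced_word_act u s : reduced s.2 -> reduced (word_act u s).2.
Proof. by elim: u => //= a u IHu ok_s; apply/reduced_rho_act/IHu. Qed.

Lemma word_act_cat u v s : word_act (u ++ v) s = word_act u (word_act v s).
Proof. exact: foldr_cat. Qed.

Lemma rho_letterE i : 0 < i <= n -> (rho_letter n i).+1 = i.
Proof. by move=> hi; rewrite /rho_letter inordK; lia. Qed.

Lemma word_act_nseq l s : reduced s.2 ->
  word_act (nseq l (rho_letter n n)) s = shift l%:Z s.
Proof.
move=> ok_s; elim: l => [|l IHl] /=; first by rewrite shift0.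
rewrite rho_letterE ?leqnn ?(ltnW n_ge2) // IHl rho_actn // shiftD.
by rewrite -PoszD.
Qed.

(** Both sides of the relation act as [x^(i+1) y^(-yexp i)]. *)
Lemma word_act_rel u v s : torus_rel m u v -> reduced s.2 ->
  word_act u s = word_act v s.
Proof.
case=> i [hi -> ->] ok_s /=.
rewrite word_act_cat !word_act_nseq //=; last exact: reduced_rho_act.
rewrite !rho_letterE //; try lia.
rewrite /rho_act !shiftD yexp1 addNr shift0 xactD // add1n.
by congr (xact _ (shift _ _)); rewrite yexpS; lia.
Qed.

Lemma word_act_congr u v s : congr_gen (@torus_rel n m) u v -> reduced s.2 ->
  word_act u s = word_act v s.
Proof.
move=> uv; elim: uv s => {u v}.
- by move=> u v uv s; apply: word_act_rel.
- by [].
- by move=> u v _ IH s ok_s; rewrite IH.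
- by move=> u v w _ IHu _ IHv s ok_s; rewrite IHu // IHv.
move=> u u' v v' _ IHu _ IHv s ok_s.
by rewrite !word_act_cat IHv // IHu // reduced_word_act.
Qed.

Definition mon_act (g : torus_monoid n m) s : state :=
  word_act (presented_word g) s.

Lemma mon_act_class u s : reduced s.2 ->
  mon_act (word_class (@torus_rel n m) u) s = word_act u s.
Proof.
apply: word_act_congr; apply/(word_class_eqP (@torus_rel n m)).
by rewrite presented_wordK.
Qed.

Lemma reduced_mon_act g s : reduced s.2 -> reduced (mon_act g s).2.
Proof. exact: reduced_word_act. Qed.

Lemma mon_actM g h s : reduced s.2 ->
  mon_act (g * h) s = mon_act g (mon_act h s).
Proof.
by move=> ok_s; rewrite /mon_act -word_act_cat -[RHS]mon_act_class.
Qed.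

Lemma mon_act_rho i s : 0 < i <= n -> reduced s.2 ->
  mon_act (rho i) s = rho_act i s.
Proof. by move=> hi ok_s; rewrite mon_act_class //= rho_letterE. Qed.

Lemma mon_act_exp l s : reduced s.2 -> mon_act (y ^+ l) s = shift l%:Z s.
Proof.
by move=> ok_s; rewrite -word_act_nseq // -mon_act_class // word_class_nseq.
Qed.

(** * Reading normal forms back in the monoid *)

Fixpoint letters_val w : torus_monoid n m :=
  if w is (j, b) :: w' then
    rho j * y ^+ `|(b + (yexp j)%:Z)%R|%N * letters_val w'
  else 1.

(** The absolute values, here and in [letters_val], are casts to [nat]: their arguments are
    nonnegative for a reduced word with [0 <= z]. *)
Definition state_val s : torus_monoid n m := y ^+ `|s.1|%N * letters_val s.2.

Lemma expym_central a g : y ^+ (a * m) * g = g * y ^+ (a * m).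
Proof.
rewrite -[g]presented_wordK; elim: (presented_word g) => [|c u IHu].
  by rewrite [RHS]mul1g [LHS]mulg1.
rewrite -cat1s word_class_cat -[RHS]mulgA -IHu !mulgA; congr (_ * _).
have -> : word_class (@torus_rel n m) [:: c] = rho c.+1.
  by rewrite /Defs.rho /generator /rho_letter inord_val.
rewrite mulnC expgnA; apply/esym/commuteX; rewrite /commute expym_rho //=.
by have := ltn_ord c; lia.
Qed.

(** Reduction only extracts a power [y^(l * m)] with [0 <= l] from the first syllable, and this
    power is central in the monoid itself. *)
Lemma state_val_normalize p (a : nat) b w : 0 < p < n ->
  (0 <= b + (yexp p)%:Z)%R ->
  let s := normalize p (a * m)%N%:Z b w in
  (0 <= s.1)%R /\ state_val s =
    y ^+ (a * m) * (rho p * y ^+ `|(b + (yexp p)%:Z)%R|%N * letters_val w).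
Proof.
case/andP=> p_gt0 ltpn; set e := (b + _)%R => e_ge0 /=.
rewrite /normalize modn_small // divn_small // muln0 addr0 eqn0Ngt p_gt0 /=.
have [l el] : exists l : nat, (e %/ m)%Z = l.
  by case: (e) e_ge0 => // t _; exists (t %/ m); rewrite divz_nat.
have [t et] : exists t : nat, (e %% m)%Z = t.
  have: (0 <= (e %% m)%Z)%R by rewrite modz_ge0 // m_neq0.
  by case: (e %% m)%Z => // t _; exists t.
have ee : e = (l * m + t)%N by rewrite (divz_eq e m) el et PoszD PoszM.
rewrite -/e el; split; first by rewrite -PoszM -PoszD.
rewrite /state_val -PoszM /=.
have -> : (b - (l * m)%N%:Z + (yexp p)%:Z)%R = t%:Z.
  by move: ee; rewrite /e PoszD => h; lia.
by rewrite ee /= !expgnDr -!mulgA; congr (_ * _); rewrite !mulgA expym_central.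
Qed.

Lemma state_val_rho_act i s : 0 < i <= n -> reduced s.2 -> (0 <= s.1)%R ->
  (0 <= (rho_act i s).1)%R /\ state_val (rho_act i s) = rho i * state_val s.
Proof.
case: s => [[Z|//] w] /= /andP[i_gt0].
rewrite leq_eqVlt => /orP[/eqP->|ltin] ok_w _.
  by rewrite rho_actn //= /state_val /= add1n expgS -mulgA.
rewrite /rho_act /xact /=; set z := (_ + _)%R.
have hi : 0 < i < n by rewrite i_gt0.
have hin : 0 < i <= n by rewrite i_gt0 ltnW.
have ltfi := yexp_lt hin.
case: ifP => [/dvdzP[d ed] | _]; last first.
  have ez : (z + (yexp i)%:Z = Z%:Z)%R by rewrite /z; lia.
  have := @state_val_normalize i 0 z w hi; rewrite ez mul0n mul1g.
  by case=> // -> ->; rewrite -mulgA.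
(* [z] is a multiple of [m] above [-m], because [yexp i < m]; hence it is nonnegative and
   [rho_i y^Z = y^(a * m) x^i]. *)
have {d ed}[a ez eZ] : exists2 a : nat, z = (a * m)%N%:Z & Z = a * m + yexp i.
  have [a ea] : exists a : nat, d = a%:Z.
    case: d ed => [a|a] ed; first by exists a.
    by exfalso; move: ed; rewrite /z NegzE; nia.
  exists a; first by rewrite ed ea PoszM.
  by move: ed; rewrite ea -PoszM /z; lia.
have -> : rho i * state_val (Z%:Z, w) =
    y ^+ (a * m) * (x ^+ i * letters_val w).
  rewrite /state_val /= eZ expx // expgnDr !mulgA.
  by rewrite -(expym_central a (rho i)).
rewrite ez; case: w ok_w => [_ | [j b] w /= /and5P[hj b1 b2 _ ok_w]].
  have := @state_val_normalize i a 0 [::] hi; rewrite add0r => -[] // -> ->.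
  by rewrite expx.
have [t et] : exists t : nat, (b + (yexp j)%:Z)%R = t.
  by case: (b + _)%R b1 => // t _; exists t.
have eb : (b = t%:Z - (yexp j)%:Z)%R by rewrite -et; lia.
have ltfj : yexp j < m by apply: yexp_lt; lia.
rewrite et /= !mulgA; case: (ltngtP (i + j) n) => ltij.
- have lef : yexp j <= yexp (i + j) by apply: leq_yexp; lia.
  have hij : 0 < i + j < n by lia.
  have eb' : (b + (yexp (i + j))%:Z = (yexp (i + j) - yexp j + t)%N%:Z)%R.
    by rewrite eb; lia.
  have := @state_val_normalize (i + j) a b w hij; rewrite eb' => -[] // -> ->.
  split=> //; rewrite -[_ * _ * rho j]mulgA expx_rho; try lia.
  by rewrite addnC expgnDr !mulgA.
- have eb' : (b + (yexp (i + j - n))%:Z + m%:Z =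
      (yexp (i + j - n) + m - yexp j + t)%N%:Z)%R by rewrite eb; lia.
  have hij : 0 < i + j - n < n by lia.
  have -> : normalize (i + j) (a * m)%N%:Z b w =
      normalize (i + j - n) (a * m)%N%:Z (m%:Z + b)%R w.
    have {1}-> : i + j = i + j - n + 1 * n by lia.
    by rewrite normalize_addn muln1 addrC normalizeM.
  have := @state_val_normalize (i + j - n) a (m%:Z + b)%R w hij.
  rewrite -addrA addrC eb' => -[] // -> ->.
  split=> //; rewrite -[_ * _ * rho j]mulgA expx_rho_wrap; try lia.
  by rewrite addnC expgnDr [j + i]addnC !mulgA.
have -> : normalize (i + j) (a * m)%N%:Z b w =
    ((a * m + (m - yexp j + t))%N%:Z, w).
  rewrite ltij /normalize modnn divnn (ltnW n_ge2) muln1 eb /=.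
  by congr (_, _); lia.
split=> //; rewrite /state_val /= expgnDr -[_ * _ * rho j]mulgA.
have -> : i = n - j by lia.
rewrite expx_rhoC; last by lia.
by rewrite expgnDr !mulgA.
Qed.

Definition normal_form g : state := mon_act g (0%R, [::]).

(** Reading back inverts [normal_form], so normal forms separate the elements of the monoid. *)
Lemma normal_form_spec g :
  (0 <= (normal_form g).1)%R /\ state_val (normal_form g) = g.
Proof.
suff H u : (0 <= (word_act u (0%R, [::])).1)%R /\
    state_val (word_act u (0%R, [::])) = word_class (@torus_rel n m) u.
  by rewrite /normal_form -{3}[g]presented_wordK; apply: H.
elim: u => [|c u [IH1 IH2]] /=; first by rewrite /state_val mulg1.
have hc : 0 < c.+1 <= n by have := ltn_ord c; lia.
have [|-> ->] := @state_val_rho_act c.+1 _ hc _ IH1;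
  first exact: reduced_word_act.
split=> //; rewrite IH2 -cat1s word_class_cat.
by rewrite /Defs.rho /generator /rho_letter inord_val.
Qed.

Lemma expy_left_divides l g :
  left_divides (y ^+ l) g <-> (l%:Z <= (normal_form g).1)%R.
Proof.
split=> [[h <-] | lel].
  rewrite /normal_form mon_actM // mon_act_exp; last exact: reduced_mon_act.
  by rewrite /= lerDl; have [] := normal_form_spec h.
have [t0 <-] := normal_form_spec g; rewrite /state_val.
case: (normal_form g) lel t0 => [[t|//] w] /=; rewrite lez_nat => lel _.
by exists (y ^+ (t - l) * letters_val w); rewrite mulgA -expgnDr subnKC.
Qed.

(** * Left divisibility and the right-lcm *)

Lemma rho_left_divides_expy i : 0 < i <= n ->
  left_divides (rho i) (y ^+ (m - q)).
Proof.
case/andP=> i_gt0; have eq1 := @yexp_pred.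
rewrite leq_eqVlt => /orP[/eqP->|ltin].
  exists (y ^+ (m - q).-1); rewrite -expgS prednK //; lia.
have hn : 0 < n - i <= n by lia.
have leq_q : q <= yexp (n - i) by rewrite -[leqLHS]yexp1 leq_yexp //; lia.
have ltf := yexp_lt hn.
(* The first factor completes [rho_i] to [x^i], which collapses against [rho (n - i)]; the last one
   pads the exponent to [m - q]. *)
exists (y ^+ yexp i * (rho (n - i) * y ^+ (yexp (n - i) - q))).
rewrite mulgA -expx; last by rewrite i_gt0 ltnW.
have {1}-> : i = n - (n - i) by lia.
by rewrite mulgA expx_rhoC // -expgnDr addnBA // subnK // ltnW.
Qed.

Lemma dvd_normalize p z b w : (m %| z)%Z -> p %% n != 0 ->
  (m %| (normalize p z b w).1)%Z.
Proof.
move=> mz /negPf p0; rewrite /normalize p0 /=.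
by rewrite rpredD ?dvdz_mull // rpredD // PoszM dvdz_mulr.
Qed.

Lemma mul_m_ge0 (d : int) : (- m%:Z < d * m%:Z)%R -> (0 <= d * m%:Z)%R.
Proof.
have m_gt0 : (0 < m%:Z)%R by rewrite ltz_nat (leq_ltn_trans _ ltnm).
by rewrite -mulN1r ltr_pM2r // => d_ge0; apply: mulr_ge0; lia.
Qed.

Lemma mul_m_ge (d : int) : (0 < d * m%:Z)%R -> (m%:Z <= d * m%:Z)%R.
Proof.
have m_gt0 : (0 < m%:Z)%R by rewrite ltz_nat (leq_ltn_trans _ ltnm).
by rewrite pmulr_lgt0 // => d_gt0; rewrite ler_peMl //; lia.
Qed.

(** [x^(n-1)] leaves a leading exponent not divisible by [m] only on meeting a first syllable
    [x y^b]. Then [x^n = y^m] frees [y^(m+b)], and [b >= -q] since [yexp 1 = q]. *)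
Lemma rho_act_pred s : reduced s.2 -> (0 <= s.1)%R ->
  (m %| (rho_act n.-1 s).1)%Z \/ (m%:Z - q%:Z <= (rho_act n.-1 s).1)%R.
Proof.
have hf := yexp_pred; have mgt0 := leq_ltn_trans (leq0n n) ltnm.
case: s => z w /= ok_w z_ge0; rewrite /rho_act /xact /=.
set z' : int := (_ + z)%R; have p0 : n.-1 %% n != 0 by rewrite modn_small; lia.
case: ifP => mz'; last by left; apply: dvd_normalize.
case: w ok_w => [|[j b] w] /=; first by left; apply: dvd_normalize.
case/and5P=> hj b1 b2 _ ok_w; case: (eqVneq j 1%N) => [j1 | jn1].
  right; rewrite j1 addn1 prednK ?(ltnW n_ge2) //.
  rewrite /normalize modnn divnn (ltnW n_ge2) muln1 /=.
  move: b1; rewrite j1 yexp1 => b1.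
  suff : (0 <= z')%R by lia.
  by case/dvdzP: mz' => d ed; rewrite ed mul_m_ge0 // -ed /z';
    move: (m %/ n) hf z_ge0 mgt0; clear; lia.
left; apply: dvd_normalize => //.
have -> : n.-1 + j = j.-1 + n by lia.
by rewrite modnDr modn_small; lia.
Qed.

(** Divisibility by [y] makes the leading exponent positive, and a positive multiple of [m] is at
    least [m]. *)
Lemma expy_left_lcm g : left_divides (rho n.-1) g -> left_divides y g ->
  left_divides (y ^+ (m - q)) g.
Proof.
move=> [h <-] hy; apply/expy_left_divides.
have : (1 <= (normal_form (rho n.-1 * h)%g).1)%R.
  by apply/(@expy_left_divides 1).
rewrite /normal_form mon_actM // mon_act_rho ?reduced_mon_act //; last lia.
have [h0 _] := normal_form_spec h; have := yexp_pred => hf.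
have [|//|/dvdzP[d ed]|le_t] := @rho_act_pred (normal_form h);
  first exact: reduced_mon_act.
  by rewrite ed => t_gt0; rewrite (le_trans _ (mul_m_ge t_gt0)) //
    lez_nat leq_subr.
by move=> _; apply: le_trans le_t; rewrite subzn // leq_div.
Qed.

(** * Right divisibility and the left-lcm *)

Lemma rho_right_divides_expy i : 0 < i <= n ->
  right_divides (rho i) (y ^+ (m - q)).
Proof.
case/andP=> i_gt0; rewrite leq_eqVlt => /orP[/eqP->|ltin].
  exists (y ^+ (m - q).-1); rewrite -expgSr prednK //.
  by have := yexp_pred; lia.
have hi : 0 < i <= n by rewrite i_gt0 ltnW.
have lef : q <= yexp i by rewrite -[leqLHS]yexp1 leq_yexp.
have ltf := yexp_lt hi.
exists (y ^+ (yexp i - q) * x ^+ (n - i)).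
by rewrite -mulgA expx_rhoC // -expgnDr addnC addnBA // subnK // ltnW.
Qed.

(** For [i = 1] the target is [x^(n-2) rho_1]. For [2 <= i < n], [x^(n-i) rho_i = y^(m - yexp i)]
    fits in its tail because [yexp i >= yexp 2 = 2q + 1]. *)
Lemma rho_right_divides_rho_pred i : D 1 = 1%N -> 0 < i <= n ->
  right_divides (rho i) (rho n.-1 * y ^+ (m.-1 - 2 * q)).
Proof.
move=> D1 /andP[i_gt0]; have hf := yexp_pred.
have n3 : 2 < n.
  rewrite ltn_neqAle n_ge2 andbT; apply/eqP => n2.
  by move: yexpn; rewrite -n2 yexp2 D1; move: hf; rewrite -n2 /= yexp1; lia.
have q_gt0 : 0 < q by rewrite divn_gt0 ?(ltnW n_ge2) // ltnW.
have lef2 : (q + q + 1)%N <= yexp n.-1 by rewrite -D1 -yexp2 leq_yexp //; lia.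
rewrite leq_eqVlt => /orP[/eqP->|ltin].
  exists (rho n.-1 * y ^+ (m.-1 - 2 * q).-1).
  by rewrite -mulgA -expgSr prednK //; lia.
have hi : 0 < i <= n by rewrite i_gt0 ltnW.
have ltf := yexp_lt hi.
case: (eqVneq i 1%N) => [->|in1].
  exists (x ^+ (n - 2)); rewrite expx_rho //; last lia.
  have -> : (1 + (n - 2))%N = n.-1 by lia.
  by rewrite yexp1; refine (congr1 (fun l : nat => rho n.-1 * y ^+ l) _); lia.
have lef : (q + q + 1)%N <= yexp i by rewrite -D1 -yexp2 leq_yexp //; lia.
exists (rho n.-1 * y ^+ (yexp i - (q + q + 1)%N) * x ^+ (n - i)).
rewrite -!mulgA expx_rhoC // -expgnDr.
by refine (congr1 (fun l : nat => rho n.-1 * y ^+ l) _); lia.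
Qed.

Lemma rho_act_letter j (e : int) s : 0 < j <= n -> reduced s.2 ->
  (0 <= e + (yexp j)%:Z)%R ->
  mon_act (rho j * y ^+ `|(e + (yexp j)%:Z)%R|%N) s = xact j (shift e s).
Proof.
move=> hj ok_s e_ge0; rewrite mon_actM // mon_act_exp // mon_act_rho //.
rewrite /rho_act shiftD gez0_abs //.
by congr (xact _ (shift _ _)); ring.
Qed.

(** A multiple of [m] in front travels left unchanged: each earlier syllable [x^k y^c] has [c] not
    divisible by [m], so nothing merges, and [0 <= c + yexp k < m], so nothing is carried. *)
Lemma letters_act w j b s : reduced (rcons w (j, b)) -> reduced s.2 ->
  (m %| (xact j (shift b s)).1)%Z ->
  (mon_act (letters_val (rcons w (j, b))) s).1 = (xact j (shift b s)).1.
Proof.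
move=> ok_w ok_s; set t := (xact _ _).1 => mt.
elim: w ok_w => [/and5P[hj b1 _ _ _] | [k c] w IHw /= /and5P[hj b1 b2 hb ok_w]].
  by rewrite /= mulg1 rho_act_letter //; lia.
have {IHw} := IHw ok_w; set u := letters_val _ => IHw.
have ok_u : reduced (mon_act u s).2 by apply: reduced_mon_act.
rewrite mon_actM // rho_act_letter //; last lia.
have mc : ~~ (m %| c)%Z by move: hb; rewrite /nilp size_rcons.
rewrite /xact /= IHw rpredDr // (negPf mc) /normalize.
rewrite modn_small ?divn_small; try lia.
rewrite muln0 add0r ifF /=; last lia.
have /dvdzP[d ed] := mt.
have e1 : (c + d * m%:Z + (yexp k)%:Z = d * m%:Z + (c + (yexp k)%:Z))%R by ring.
rewrite ed e1 divzMDl ?m_neq0 //.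
by rewrite divz_small ?addr0 ?add0r // b1.
Qed.

(* Normal form of [rho_i^-1 = y^(f i) x^(-i) = y^(f i - m) x^(n-i)]. *)
Definition inv_state i : state :=
  ((yexp i)%:Z - m%:Z, if (i < n)%N then [:: ((n - i)%N, 0%R)] else [::])%R.

Lemma reduced_inv_state i : 0 < i <= n -> reduced (inv_state i).2.
Proof.
move=> hi; rewrite /inv_state /=; case: ifP => //= ltin.
have /yexp_lt : 0 < n - i <= n by lia.
by rewrite andbT; lia.
Qed.

Lemma rho_act_inv_state i : 0 < i <= n ->
  rho_act i (inv_state i) = (0%R, [::]).
Proof.
move=> hi; rewrite /rho_act /inv_state /shift /= addKr /xact /= rpredN dvdzz.
case: (ltnP i n) => [ltin | leni].
  rewrite /= subnKC ?(ltnW ltin) // /normalize modnn divnn (ltnW n_ge2).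
  rewrite muln1 /=.
  by rewrite addr0 addNr.
have -> : i = n by lia.
by rewrite /normalize modnn divnn (ltnW n_ge2) muln1 /= addr0 addNr.
Qed.

(** If [g = h rho_i], acting on the state of [rho_i^-1] yields the normal form of [h]. *)
Lemma right_divides_act i g : 0 < i <= n -> right_divides (rho i) g ->
  (0 <= (mon_act g (inv_state i)).1)%R.
Proof.
move=> hi [h <-]; have ok_i := reduced_inv_state hi.
rewrite mon_actM // mon_act_rho // rho_act_inv_state //.
by have [] := normal_form_spec h.
Qed.

(** In [g rho_i^-1] the last syllable becomes [x^j y^(b + yexp i - m)], and by the condition on [b]
    it does not merge with what follows. Its carry [d * m] reaches the front, whence
    [0 <= z + d * m]. *)
Lemma right_divides_last_syllable i g z w j b :
  0 < i <= n -> right_divides (rho i) g ->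
  normal_form g = (z, rcons w (j, b)) -> reduced (rcons w (j, b)) ->
  0 < j < n -> (b + (yexp j)%:Z < m%:Z)%R ->
  ~~ (m %| (b + (yexp i)%:Z)%R)%Z ->
  (m%:Z <= z)%R \/ (m%:Z <= b + (yexp i)%:Z + (yexp j)%:Z)%R.
Proof.
move=> hi /(right_divides_act hi) + tg ok_w hj ltb mb.
have ok_i := reduced_inv_state hi; have ltf := yexp_lt hi.
have [z0 <-] := normal_form_spec g; rewrite tg in z0 *.
rewrite /state_val /= mon_actM // mon_act_exp ?reduced_mon_act //.
set s := inv_state i.
have e1 : (xact j (shift b s)).1 =
    (((b + (yexp i)%:Z + (yexp j)%:Z - m%:Z)%R %/ m)%Z * m%:Z)%R.
  rewrite /xact /s /inv_state /= addrA rpredBr ?dvdzz // (negPf mb).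
  rewrite /normalize modn_small ?divn_small; try lia.
  rewrite muln0 add0r ifF /=; last lia.
  by rewrite [(b + _ - _ + _)%R]addrAC !add0r.
rewrite /shift /= letters_act // ?e1 ?dvdz_mull //.
set d : int := divz _ _ => h.
case: (lerP m%:Z z) => [|ltz]; first by left.
right; have d0 : (0 <= d)%R by move: z0 h => /=; nia.
move: d0; rewrite /d divz_ge0; first by lia.
by rewrite ltz_nat (leq_ltn_trans _ ltnm).
Qed.

Lemma right_divides_trans (M : monoidType) (a b c : M) :
  right_divides a b -> right_divides b c -> right_divides a c.
Proof. by case=> u <- [v <-]; exists (v * u); rewrite mulgA. Qed.

Lemma right_divides_exp (M : monoidType) (a : M) k1 k2 : k1 <= k2 ->
  right_divides (a ^+ k1) (a ^+ k2).
Proof. by exists (a ^+ (k2 - k1)); rewrite -expgnDr subnK. Qed.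

Lemma letters_val_rcons w j b : letters_val (rcons w (j, b)) =
  letters_val w * (rho j * y ^+ `|(b + (yexp j)%:Z)%R|%N).
Proof.
by elim: w => [|[k1 c] w IHw] /=; rewrite ?mul1g ?mulg1 // IHw !mulgA.
Qed.

Lemma reduced_rcons w j b : reduced (rcons w (j, b)) ->
  0 < j < n /\ (0 <= b + (yexp j)%:Z < m%:Z)%R.
Proof.
elim: w => [/and5P[hj b1 b2 _ _] | [k1 c] w IHw /= /and5P[_ _ _ _ /IHw//]].
by rewrite b1.
Qed.

Lemma common_left_multiple_cases g :
  right_divides (rho 1) g -> right_divides (rho 2) g ->
  right_divides (y ^+ (m - q)) g \/
  D 1 = 1%N /\ right_divides (rho n.-1 * y ^+ (m.-1 - 2 * q)) g.
Proof.
move=> h1 h2; have hf := yexp_pred; have D_le1 := DD_le1 1.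
have q_gt0 : 0 < q by rewrite divn_gt0 ?(ltnW n_ge2) // ltnW.
have leqm : q * 2 <= m.
  by apply: leq_trans (leq_trunc_div m n); rewrite leq_mul2l n_ge2 orbT.
have hn1 : 0 < 1 <= n by rewrite (ltnW n_ge2).
have [t0 eg] := normal_form_spec g.
have ok_g : reduced (normal_form g).2 by apply: reduced_mon_act.
case et : (normal_form g) t0 ok_g => [[z|//] w] /= _.
case/lastP: w et => [|w [j b]] et ok_w.
  left; have := right_divides_act hn1 h1.
  rewrite -eg et /state_val /= mulg1 mon_act_exp ?reduced_inv_state //=.
  rewrite yexp1 => z_ge.
  by apply: right_divides_exp; move: (m %/ n) z_ge; clear; lia.
have [hj /andP[b1 b2]] := reduced_rcons ok_w.
have [e eb] : exists e : nat, (b + (yexp j)%:Z)%R = e.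
  by case: (b + _)%R b1 => // t _; exists t.
have eg' : g = y ^+ z * (letters_val w * (rho j * y ^+ e)).
  by rewrite -eg et /state_val letters_val_rcons eb.
have div_z : m <= z -> right_divides (y ^+ (m - q)) g.
  move=> lemz; have ym_central := expym_central 1; rewrite mul1n in ym_central.
  apply: (@right_divides_trans _ _ (y ^+ m)).
    by apply: right_divides_exp; apply: leq_subr.
  rewrite eg' -(subnK lemz) expgnDr -mulgA ym_central mulgA.
  by eexists.
have div_e : m - q <= e -> right_divides (y ^+ (m - q)) g.
  move=> le_e; apply: right_divides_trans (right_divides_exp _ le_e) _.
  by rewrite eg' !mulgA; eexists.
have ltfj : yexp j < m by apply: yexp_lt; lia.
have leqf : q <= yexp j by rewrite -[leqLHS]yexp1 leq_yexp //; lia.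
case: (boolP (m %| (b + (yexp 1)%:Z)%R)%Z) => mb; last first.
  left; have [lez|le_e] := right_divides_last_syllable hn1 h1 et ok_w hj b2 mb.
    by apply: div_z.
  by apply: div_e; move: le_e; rewrite yexp1 addrAC eb; lia.
(* The multiple [b + q] of [m] lies strictly between [-m] and [m], since [0 <= b + yexp j < m] and
   [q <= yexp j < m]. *)
have {mb}bq : (b = - q%:Z)%R.
  have /dvdzP[d ed] := mb; rewrite yexp1 in ed.
  have d0 : (0 <= b + q%:Z)%R.
    by rewrite ed mul_m_ge0 // -ed {ed d mb}; move: (m %/ n) q_gt0 b1; lia.
  have : ~ (0 < b + q%:Z)%R.
    rewrite ed => /mul_m_ge; rewrite -ed {ed d mb}.
    by move: (m %/ n) leqf b2; lia.
  by move: (m %/ n) d0; clear; lia.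
have hn2 : 0 < 2 <= n by [].
have ltqD : q + D 1 < m by lia.
have mb2 : ~~ (m %| (b + (yexp 2)%:Z)%R)%Z.
  have -> : (b + (yexp 2)%:Z)%R = (q + D 1)%N%:Z by rewrite bq yexp2; lia.
  by rewrite dvdzE /= gtnNdvd //; lia.
have [lez|le_e] := right_divides_last_syllable hn2 h2 et ok_w hj b2 mb2.
  by left; apply: div_z.
right; have ge_fj : m <= q + D 1 + yexp j by move: le_e; rewrite bq yexp2; lia.
(* [yexp n.-1 = m - 1 - q] exceeds the earlier values by at least [q], so [ge_fj] leaves only
   [j = n.-1], and then only [D 1 = 1]. *)
have ej : j = n.-1.
  apply/eqP; case: (ltngtP j n.-1) => //; last lia.
  move=> ltj; exfalso; have lefj : yexp j <= yexp n.-2 by apply: leq_yexp; lia.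
  have : yexp n.-1 = yexp n.-2 + q + D n.-2 by rewrite -yexpS ?prednK //; lia.
  move: (m %/ n) q_gt0 ge_fj hf D_le1; lia.
have lefj : yexp j <= yexp n.-1 by rewrite ej.
split; first by move: (m %/ n) ge_fj hf D_le1 lefj; lia.
have -> : (m.-1 - 2 * q)%N = e.
  by move: eb; rewrite bq ej; move: (m %/ n) hf; clear; lia.
by rewrite eg' ej mulgA; eexists.
Qed.

(** * Grading of the monoid and uniqueness of lcms *)

Definition weight (u : seq 'I_n.-1.+1) : nat :=
  foldr (fun (a : 'I_n.-1.+1) t => k a.+1 + t) 0%N u.

Lemma weight_cat u v : weight (u ++ v) = weight u + weight v.
Proof. by elim: u => //= c u ->; rewrite addnA. Qed.

(** The relations are homogeneous by [r + k i = D i * n + k i.+1]. *)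
Lemma weight_congr u v : congr_gen (@torus_rel n m) u v -> weight u = weight v.
Proof.
have weight_nseq l : weight (nseq l (rho_letter n n)) = (l * n)%N.
  by elim: l => //= l ->; rewrite rho_letterE ?kkn ?mulSn //; lia.
elim=> {u v} [u v [i [hi -> ->]]|//|//|u v w _ -> _ ->//|u u' v v' _ IHu _ IHv].
  rewrite /= weight_cat !weight_nseq /= !rho_letterE ?kk1; try lia.
  have [e _] := DDE m (ltnW n_ge2) i.
  by rewrite addn0 addnCA e mulnDl; move: (k _) (D _ * n)%N; lia.
by rewrite !weight_cat IHu IHv.
Qed.

Lemma weight0 u : weight u = 0%N -> u = [::].
Proof. by case: u => [//|c u] /=; have := kk_bounds c.+1; lia. Qed.

Definition mon_weight (g : torus_monoid n m) := weight (presented_word g).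

Lemma mon_weightM g h : mon_weight (g * h) = mon_weight g + mon_weight h.
Proof.
rewrite /mon_weight -weight_cat; apply: weight_congr.
by apply/(word_class_eqP (@torus_rel n m)); rewrite presented_wordK.
Qed.

Lemma mon_weight0 g : mon_weight g = 0%N -> g = 1.
Proof. by move/weight0 => e; rewrite -[g]presented_wordK e. Qed.

Lemma left_divides_anti (g h : torus_monoid n m) :
  left_divides g h -> left_divides h g -> g = h.
Proof.
case=> a <- [b e]; have : mon_weight g = mon_weight (g * a * b) by rewrite e.
rewrite !mon_weightM => ew.
rewrite (mon_weight0 (_ : mon_weight a = 0%N)) ?mulg1 //.
lia.
Qed.

Lemma right_divides_anti (g h : torus_monoid n m) :
  right_divides g h -> right_divides h g -> g = h.
Proof.
case=> a <- [b e]; have : mon_weight g = mon_weight (b * (a * g)) by rewrite e.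
rewrite !mon_weightM => ew.
rewrite (mon_weight0 (_ : mon_weight a = 0%N)) ?mul1g //.
lia.
Qed.

Lemma is_right_lcm_unique (I : finType) (f : I -> torus_monoid n m) g :
  is_right_lcm f g -> unique (is_right_lcm f) g.
Proof.
move=> lcm_g; split=> // h lcm_h; apply: left_divides_anti.
  by apply: lcm_g.2; apply: lcm_h.1.
by apply: lcm_h.2; apply: lcm_g.1.
Qed.

Lemma is_left_lcm_unique (I : finType) (f : I -> torus_monoid n m) g :
  is_left_lcm f g -> unique (is_left_lcm f) g.
Proof.
move=> lcm_g; split=> // h lcm_h; apply: right_divides_anti.
  by apply: lcm_g.2; apply: lcm_h.1.
by apply: lcm_h.2; apply: lcm_g.1.
Qed.

(** * The lcms of the generators *)

Lemma rho_family_all (P : torus_monoid n m -> Prop) :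
  (forall i, P (@rho_family n m i)) -> forall i, 0 < i <= n -> P (rho i).
Proof.
by move=> H [//|i] lt_in; apply: (H (Ordinal lt_in)).
Qed.

Lemma right_lcm_rho : is_right_lcm (@rho_family n m) (y ^+ (m - q)).
Proof.
split=> [i | g /(@rho_family_all (fun h => left_divides h g)) hg].
  exact: (@rho_left_divides_expy i.+1 (ltn_ord i)).
by apply: expy_left_lcm; apply: hg; lia.
Qed.

Lemma left_lcm_rho1 : D 1 = 1%N ->
  is_left_lcm (@rho_family n m) (rho n.-1 * y ^+ (m.-1 - 2 * q)).
Proof.
move=> D1; split=> [i | g /(@rho_family_all (fun h => right_divides h g)) hg].
  exact: (@rho_right_divides_rho_pred i.+1 D1 (ltn_ord i)).
have h1 := hg 1%N (ltnW n_ge2).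
have [|[]//] := common_left_multiple_cases h1 (hg 2%N n_ge2).
(* The candidate right-divides [y^(m-q)]: [x rho_(n-1) = y^(q+1)], and
   [(q + 1) + (m - 1 - 2q) = m - q]. *)
apply: right_divides_trans; exists x; have hf := yexp_pred.
have lef : q <= yexp n.-1 by rewrite -[leqLHS]yexp1 leq_yexp //; lia.
have hn1 : 0 < n.-1 <= n by lia.
have e : x * rho n.-1 = y ^+ (m - yexp n.-1).
  by rewrite -expx_rhoC //; have -> : n - n.-1 = 1%N by lia.
rewrite mulgA e -expgnDr; refine (congr1 (fun l : nat => y ^+ l) _).
by move: (m %/ n) hf lef ltnm; clear; lia.
Qed.

Lemma left_lcm_rho0 : D 1 = 0%N ->
  is_left_lcm (@rho_family n m) (y ^+ (m - q)).
Proof.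
move=> D0; split=> [i | g /(@rho_family_all (fun h => right_divides h g)) hg].
  exact: (@rho_right_divides_expy i.+1 (ltn_ord i)).
have h1 := hg 1%N (ltnW n_ge2).
have [//|[]] := common_left_multiple_cases h1 (hg 2%N n_ge2).
by rewrite D0.
Qed.

End TorusMonoid.

Theorem proposition5p10 (n m : nat) (hn : 2 <= n) (hnm : n < m)
    (hco : coprime n m) :
  unique (is_right_lcm (@rho_family n m)) (rho n m n ^+ (m - m %/ n)%N)%g /\
  ((DD n m 1 = 1%N ->
      unique (is_left_lcm (@rho_family n m))
        (rho n m n.-1 *
         rho n m n ^+ (m %/ n * (n - 2) + m %% n - 1)%N)%g) /\
   (DD n m 1 = 0%N ->
      unique (is_left_lcm (@rho_family n m)) (rho n m n ^+ (m - m %/ n)%N)%g)).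
Proof.
split; first exact/is_right_lcm_unique/right_lcm_rho.
split=> [D1 | D0]; last exact/is_left_lcm_unique/left_lcm_rho0.
apply: is_left_lcm_unique => //.
have -> : m %/ n * (n - 2) + m %% n - 1 = m.-1 - 2 * (m %/ n).
  have := divn_eq m n; rewrite mulnBr [m %/ n * 2]mulnC => em.
  have : 2 * (m %/ n) <= m %/ n * n by rewrite mulnC leq_mul2l hn orbT.
  by move: (m %/ n * n) (2 * (m %/ n)) (m %% n) em; lia.
exact: left_lcm_rho1.
Qed.
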